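(* Let $U$ be a fixed set. An object $\mathcal{F}_A$ of the category $\mathbf{Sset(U)}$ of soft sets over $U$ is an initial object if and only if $A=\emptyset$.
   Context: Let $U$ be a fixed universal set. A soft set $\mathcal{F}_A$ over $U$ consists of a set $A$ (the parameter set, an arbitrary set, possibly empty) together with a function $\mathcal{F}:A\to\mathcal{P}(U)$, where $\mathcal{P}(U)$ is the power set of $U$. A soft morphism from a soft set $\mathcal{F}_A$ to a soft set $\mathcal{G}_B$ is a function $\alpha:A\to B$ such that $\mathcal{F}(a)\subseteq(\mathcal{G}\circ\alpha)(a)$ for each $a\in A$; formally it is regarded as the triple $(\mathcal{F}_A,\alpha,\mathcal{G}_B)$. Composition is composition of functions and the identity soft morphism is the identity function. $\mathbf{Sset(U)}$ is the category whose objects are all soft sets over $U$ and whose morphisms are the soft morphisms. An object $X$ of a category is an initial object if for each object $Y$, $|\hom(X,Y)|=1$. *)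

(* Defs.v *)
From mathcomp Require Import all_boot.
From mathcomp Require Import boolp classical_sets functions cardinality.

Set Implicit Arguments.
Unset Strict Implicit.
Unset Printing Implicit Defensive.

Local Open Scope classical_set_scope.
Local Open Scope card_scope.

Record category : Type := Category {
  obj : Type;
  hom : obj -> obj -> Type;
  idm : forall X, hom X X;
  compm : forall X Y Z, hom Y Z -> hom X Y -> hom X Z;
  comp_idl : forall X Y (f : hom X Y), compm (idm Y) f = f;
  comp_idr : forall X Y (f : hom X Y), compm f (idm X) = f;
  compmA : forall W X Y Z (h : hom Y Z) (g : hom X Y) (f : hom W X),
    compm h (compm g f) = compm (compm h g) f
}.

(* |hom(X, Y)| = 1 for every object Y, as an equality of cardinals. *)
Definition initial_object (C : category) (X : obj C) : Prop :=
  forall Y : obj C, [set: hom X Y] #= `I_1.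

(* The parameter set of a soft set is an arbitrary set, modelled by a type,
   possibly empty and unrelated to U. *)
Record soft_set (U : Type) : Type := SoftSet {
  param : Type;
  soft_fun :> param -> set U
}.

(* Source and target are recorded in the type of the morphism, which plays the
   role of the triple (F_A, alpha, G_B). *)
Record soft_morphism (U : Type) (F G : soft_set U) : Type := SoftMorphism {
  morph_fun :> param F -> param G;
  morph_sub : forall a : param F, F a `<=` (G \o morph_fun) a
}.

Arguments morph_sub {U F G} f a _ _ : rename.

Lemma soft_morphism_eq (U : Type) (F G : soft_set U)
    (f g : soft_morphism F G) : (f : param F -> param G) = g -> f = g.
Proof.
case: f g => [f sf] [g sg] /= efg; case: _ / efg sg => sg.
by congr SoftMorphism; exact: Prop_irrelevance.
Qed.

Definition soft_id (U : Type) (F : soft_set U) : soft_morphism F F :=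
  @SoftMorphism U F F id (fun a => @subset_refl _ (F a)).

Definition soft_comp (U : Type) (F G H : soft_set U)
    (g : soft_morphism G H) (f : soft_morphism F G) : soft_morphism F H :=
  @SoftMorphism U F H (g \o f)
    (fun a => subset_trans (morph_sub f a) (morph_sub g (f a))).

Lemma soft_comp_idl (U : Type) (F G : soft_set U) (f : soft_morphism F G) :
  soft_comp (soft_id G) f = f.
Proof. exact: soft_morphism_eq. Qed.

Lemma soft_comp_idr (U : Type) (F G : soft_set U) (f : soft_morphism F G) :
  soft_comp f (soft_id F) = f.
Proof. exact: soft_morphism_eq. Qed.

Lemma soft_compA (U : Type) (F G H K : soft_set U) (h : soft_morphism H K)
    (g : soft_morphism G H) (f : soft_morphism F G) :
  soft_comp h (soft_comp g f) = soft_comp (soft_comp h g) f.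
Proof. exact: soft_morphism_eq. Qed.

Definition Sset (U : Type) : category :=
  @Category (soft_set U) (@soft_morphism U) (@soft_id U) (@soft_comp U)
    (@soft_comp_idl U) (@soft_comp_idr U) (@soft_compA U).

(* Main.v *)
Require Import Defs.
From mathcomp Require Import all_boot.
From mathcomp Require Import boolp classical_sets functions cardinality.

Local Open Scope classical_set_scope.

(** A function into an empty set has an empty domain, so a morphism to the soft set without
    parameters forces [param F] to be empty. Conversely, an empty domain has exactly one function to
    any set, and the inclusion condition is vacuous. *)

Theorem theorem1 (U : Type) (F : obj (Sset U)) :
  initial_object F <-> [set: param F] = set0.
Proof.
split=> [initF | F0 G].
  rewrite -subset0 => a _.
  have /card_set_bijP[f [_ _ surjf]] := initF (SoftSet (of_void (set U))).
  (* The preimage of [0] under the bijection is a morphism [g] into the soft set over [void]; it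
     would send [a] to an element of [void]. *)
  by have [g _ _] := surjf 0 isT; case: (morph_fun g a).
have noparam (a : param F) : False.
  by have : [set: param F] a by []; rewrite F0.
pose e : soft_morphism F G :=
  @SoftMorphism U F G (fun a => False_rect (param G) (noparam a))
    (fun a => False_ind _ (noparam a)).
suff -> : [set: hom F G] = [set e] by exact: card_set1.
apply/esym; rewrite -subTset => f _; apply: soft_morphism_eq.
by apply/funext => a; case: (noparam a).
Qed.
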